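(* Let $\mathcal{C}$ be a binary linear code of length $n$ and dimension $k$, used with BPSK (codeword $\underline c$ mapped to $\underline s$ with $s_t=1-2c_t$) over the AWGN channel $\underline y=\underline s+\underline z$, $\underline z$ with i.i.d. $\mathcal{N}(0,\sigma^2)$ components, $\sigma>0$, and maximum-likelihood (minimum Euclidean distance) decoding. Assume the all-zero codeword $\underline c^{(0)}$ is transmitted and let $E=\bigcup_{\underline s\neq\underline s^{(0)}}\{\underline s^{(0)}\to\underline s\}$ be the error event. Let $\underline c^{(1)}$ be any fixed codeword with $W_H(\underline c^{(1)})=d_1\ge1$, and let $\{B_{i,j}\}$ be the triangle spectrum of $\mathcal{C}$ with respect to $\underline c^{(1)}$. Then $${\rm Pr}\{E\}\le-(2^k-3)\,Q(\sqrt{d_1}/\sigma)+\sum_{1\le i,j\le n}B_{i,j}\,p_3(i,j),$$ where $p_3(i,j)=1-\iint_{\Omega}f(\xi_1)f(\xi_2)\,d\xi_1d\xi_2$ with $f(x)=\frac{1}{\sqrt{2\pi}\sigma}e^{-x^2/(2\sigma^2)}$, $\Omega=\{(\xi_1,\xi_2):\xi_1<\sqrt{d_1},\ \xi_1\cos\theta+\xi_2\sin\theta<\sqrt{i}\}$ and $\theta\in[0,\pi]$ with $\cos\theta=(d_1+i-j)/(2\sqrt{d_1 i})$.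
   Context: $W_H$ is Hamming weight; $Q(x)=\int_x^\infty\frac{1}{\sqrt{2\pi}}e^{-t^2/2}dt$. The event $\{\underline s^{(0)}\to\underline s\}$ is $\{\underline y:\|\underline y-\underline s\|\le\|\underline y-\underline s^{(0)}\|\}$. The triangle spectrum with respect to $\underline c^{(1)}$: $B_{i,j}$ is the number of codewords $\underline c$ with $W_H(\underline c)=i$ and $W_H(\underline c-\underline c^{(1)})=j$ (so the sum over $i,j\ge1$ counts all codewords other than $\underline c^{(0)}$ and $\underline c^{(1)}$). For such a codeword $\underline c$ with bipolar image $\underline s$, $p_3(i,j)$ equals ${\rm Pr}\{(\underline s^{(0)}\to\underline s^{(1)})\cup(\underline s^{(0)}\to\underline s)\}$. *)

(* Defs.v *)
From HB Require Import structures.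
From mathcomp Require Import all_boot all_order all_algebra.
From mathcomp Require Import all_classical all_reals all_analysis.
Set Implicit Arguments. Unset Strict Implicit. Unset Printing Implicit Defensive.
Import Order.TTheory GRing.Theory Num.Theory.
Import numFieldNormedType.Exports.
Local Open Scope classical_set_scope.
Local Open Scope ring_scope.

Section Defs.
Variable R : realType.

Definition wH (n : nat) (c : 'rV['F_2]_n) : nat := #|[set t : 'I_n | c 0 t != 0]|.

Definition bpsk (n : nat) (c : 'rV['F_2]_n) (t : 'I_n) : R :=
  1 - 2 * (c 0 t != 0)%:R.

Definition gdens (sigma x : R) : R :=
  (Num.sqrt (2 * pi) * sigma)^-1 * expR (- (x ^+ 2) / (2 * sigma ^+ 2)).

Definition Qfun (x : R) : \bar R :=
  (\int[@lebesgue_measure R]_(t in `[x, +oo[) (gdens 1 t)%:E)%E.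

Definition upd (z : nat -> R) (m : nat) (x : R) : nat -> R :=
  fun t => if t == m then x else z t.

(* giter sigma m g z : integrate coordinates 0..m-1 of z against the
   N(0,sigma^2) density (i.i.d. noise), applied to g *)
Fixpoint giter (sigma : R) (m : nat) (g : (nat -> R) -> \bar R)
  : (nat -> R) -> \bar R :=
  match m with
  | 0 => g
  | m'.+1 => giter sigma m'
      (fun z => (\int[@lebesgue_measure R]_x ((gdens sigma x)%:E * g (upd z m' x)))%E)
  end.

Definition noise_prob (sigma : R) (n : nat) (P : (nat -> R) -> bool) : \bar R :=
  giter sigma n (fun z => (if P z then 1 else 0)%:E) (fun _ => 0).

Definition dist2 (n : nat) (z : nat -> R) (y_from s : 'I_n -> R) : R :=
  \sum_(t < n) (y_from t + z t - s t) ^+ 2.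

(* Error event E = union over codewords c <> c^(0)=0 of {s^(0) -> s},
   where y = s^(0) + z and {s^(0) -> s} = {||y - s|| <= ||y - s^(0)||} *)
Definition error_event (n : nat) (C : {set 'rV['F_2]_n}) (z : nat -> R) : bool :=
  [exists c in C, (c != 0) &&
     (dist2 z (bpsk (0 : 'rV['F_2]_n)) (bpsk c)
        <= dist2 z (bpsk (0 : 'rV['F_2]_n)) (bpsk (0 : 'rV['F_2]_n)))].

Definition error_prob (sigma : R) (n : nat) (C : {set 'rV['F_2]_n}) : \bar R :=
  noise_prob sigma n (error_event C).

Definition tri_spec (n : nat) (C : {set 'rV['F_2]_n}) (c1 : 'rV['F_2]_n) (i j : nat) : nat :=
  #|[set c in C | (wH c == i) && (wH (c - c1) == j)]|.

Definition p3 (sigma : R) (d1 i j : nat) : \bar R :=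
  let th := acos ((d1%:R + i%:R - j%:R) / (2 * Num.sqrt (d1%:R * i%:R))) in
  (1 - \int[@lebesgue_measure R]_x1 \int[@lebesgue_measure R]_x2
     ((gdens sigma x1 * gdens sigma x2 *
       (if (x1 < Num.sqrt d1%:R) && (x1 * cos th + x2 * sin th < Num.sqrt i%:R)
        then 1 else 0))%:E))%E.

End Defs.

(* Main.v *)
Require Import Defs.
From HB Require Import structures.
From mathcomp Require Import all_boot all_order all_algebra.
From mathcomp Require Import all_classical all_reals all_analysis.
From mathcomp Require Import measurable_realfun ring lra.
Import Order.TTheory GRing.Theory Num.Theory.
Import numFieldNormedType.Exports.
Set Implicit Arguments. Unset Strict Implicit. Unset Printing Implicit Defensive.
Local Open Scope classical_set_scope.
Local Open Scope ring_scope.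

(** Write [A c] for the event that the image of [c] is at least as close to the
    received word as that of the zero codeword. The error event is contained in
    [A c1] together with the sets [A c \ A c1] for [c] other than [0] and [c1],
    and [Pr (A c \ A c1) = Pr (A c1 \/ A c) - Pr (A c1)]; there are [2 ^ k - 2]
    such [c]. Each [A c] is a half-space [<u_c, z> >= sqrt (wH c)] with [u_c] a
    unit vector, so that [Pr (A c1)] and [Pr (A c1 \/ A c)] only depend on the
    joint law of [<u_c1, z>] and [<u_c, z>], a planar Gaussian determined by the
    angle between the two vectors. Its law is computed by adding one coordinate
    of [z] at a time, using that the planar standard Gaussian is invariant under
    rotations; a rotation is a product of three shears, under which Lebesgue
    measure is invariant by Fubini and translation invariance. *)

(** * Rotations of the plane *)

Section shear.
Context {R : realType}.
Local Open Scope ereal_scope.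
Local Notation mu := (@lebesgue_measure R).
Local Notation RR := (measurableTypeR R).

(** Both measures give a half-open interval its length, and this property characterises Lebesgue
    measure. *)
Lemma lebesgue_measureD (a : R) (A : set R) : measurable A ->
  pushforward mu (fun x : RR => (x + a)%R : RR) A = mu A.
Proof.
have ma : measurable_fun setT (fun x : RR => (x + a)%R : RR).
  exact: measurable_funD.
pose m1 := isMeasurableFun.Build _ _ _ _ _ ma.
pose m2 : {mfun _ >-> _} := HB.pack (fun x : RR => (x + a)%R : RR) m1.
move=> mA; apply/esym.
apply: (@lebesgue_measure_unique _ (pushforward mu m2)) => //= _ [[b c]] _ <-.
rewrite /pushforward.
have -> : m2 @^-1` `]b, c] = `](b - a)%R, (c - a)%R]%classic.
  by apply/seteqP; split => x /=; rewrite !in_itv/= ltrBlDr lerBrDr.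
rewrite !lebesgue_measure_itv/= !lte_fin ltrD2r -!EFinD.
by case: ifP => // _; congr EFin; ring.
Qed.

Lemma ge0_integral_shift (a : R) (f : R -> \bar R) :
  measurable_fun setT f -> (forall x, 0 <= f x) ->
  \int[mu]_x f (x + a)%R = \int[mu]_x f x.
Proof.
move=> mf f0.
have ma : measurable_fun setT (fun x : RR => (x + a)%R : RR).
  exact: measurable_funD.
pose m1 := isMeasurableFun.Build _ _ _ _ _ ma.
pose m2 : {mfun _ >-> _} := HB.pack (fun x : RR => (x + a)%R : RR) m1.
transitivity (\int[pushforward mu m2]_x f x).
  by rewrite (ge0_integral_pushforward ma)//= preimage_setT.
by apply: eq_measure_integral => //= A mA _; exact: lebesgue_measureD.
Qed.

Lemma integral_shear2 (t : R) (F : R * R -> \bar R) :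
  measurable_fun setT F -> (forall z, 0 <= F z) ->
  \int[mu]_x \int[mu]_y F (x, y + t * x)%R = \int[mu]_x \int[mu]_y F (x, y).
Proof.
move=> mF F0; apply: eq_integral => x _.
rewrite (ge0_integral_shift (t * x)%R (f := fun y => F (x, y)))//.
by apply: (measurableT_comp mF); exact: pair1_measurable.
Qed.

(** Tonelli makes the sheared variable the inner one, where for fixed [y] the shear is a
    translation. *)
Lemma integral_shear1 (t : R) (F : R * R -> \bar R) :
  measurable_fun setT F -> (forall z, 0 <= F z) ->
  \int[mu]_x \int[mu]_y F (x + t * y, y)%R = \int[mu]_x \int[mu]_y F (x, y).
Proof.
move=> mF F0.
have mF1 : measurable_fun setT (fun z : R * R => F (z.1 + t * z.2, z.2)%R).
  apply: (measurableT_comp mF); apply: measurable_fun_pair => //=.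
  by apply: measurable_funD => //; apply: measurable_funM.
transitivity (\int[mu]_y \int[mu]_x F (x + t * y, y)%R).
  exact: (fubini_tonelli (m1 := mu) (m2 := mu) _ mF1).
transitivity (\int[mu]_y \int[mu]_x F (x, y)); last first.
  by apply/esym; exact: (fubini_tonelli (m1 := mu) (m2 := mu)).
apply: eq_integral => y _.
rewrite (ge0_integral_shift (t * y)%R (f := fun x => F (x, y)))//.
by apply: (measurableT_comp mF); exact: pair2_measurable.
Qed.

(* A rotation by an angle other than pi is a product of three shears. *)
Lemma integral_rotation (c s : R) (F : R * R -> \bar R) :
  (c ^+ 2 + s ^+ 2 = 1)%R -> (s = 0 -> c = 1)%R ->
  measurable_fun setT F -> (forall z, 0 <= F z) ->
  \int[mu]_x \int[mu]_y F (c * x - s * y, s * x + c * y)%R =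
  \int[mu]_x \int[mu]_y F (x, y).
Proof.
move=> cs1 s0c1 mF F0; have [s0|s0] := eqVneq s 0%R.
  rewrite s0 (s0c1 s0); apply: eq_integral => x _; apply: eq_integral => y _.
  by congr F; congr pair; ring.
(* For [c = cos a] and [s = sin a] this is [- tan (a / 2)]; the three shears have coefficients [t],
   [s], [t]. *)
pose t := (- ((1 - c) / s))%R.
have mF1 : measurable_fun setT (fun z : R * R => F (z.1 + t * z.2, z.2)%R).
  apply: (measurableT_comp mF); apply: measurable_fun_pair => //=.
  by apply: measurable_funD => //; apply: measurable_funM.
have mF2 : measurable_fun setT (fun z : R * R =>
    F (z.1 + t * (z.2 + s * z.1), z.2 + s * z.1)%R).
  apply: (measurableT_comp mF1 (g := fun z : R * R => (z.1, z.2 + s * z.1)%R)).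
  apply: measurable_fun_pair => //=.
  by apply: measurable_funD => //; apply: measurable_funM.
rewrite -(integral_shear1 t mF)//.
rewrite -(integral_shear2 s mF1)//=.
rewrite -(integral_shear1 t mF2)//=.
apply: eq_integral => x _; apply: eq_integral => y _.
congr F; congr pair; rewrite /t; last by field.
have c2 : (c ^+ 2 = 1 - s ^+ 2)%R by rewrite -cs1; ring.
transitivity (c * x - (1 - c ^+ 2) / s * y)%R; last by field.
by rewrite c2; field.
Qed.

End shear.

(** * Gaussian integrals *)

Section gauss.
Context {R : realType} (sigma : R) (sigma_gt0 : 0 < sigma).
Local Open Scope ereal_scope.
Local Notation mu := (@lebesgue_measure R).
Local Notation gdens := (gdens sigma).

(** One integration step of [giter], isolated from the sequence of coordinates. *)
Definition gauss_int (g : R -> \bar R) : \bar R :=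
  \int[mu]_x ((gdens x)%:E * g x).

Lemma gdens_normal_pdf (x : R) : gdens x = normal_pdf 0 sigma x.
Proof.
rewrite normal_pdfE ?gt_eqF// /normal_peak /normal_fun subr0 /Defs.gdens.
congr (_^-1 * expR (_ / _))%R; last by ring.
have -> : (sigma ^+ 2 * pi *+ 2 = sigma ^+ 2 * (2 * pi))%R by ring.
by rewrite [RHS]sqrtrM ?sqr_ge0// sqrtr_sqr gtr0_norm// mulrC.
Qed.

Lemma gdens_ge0 (x : R) : (0 <= gdens x)%R.
Proof. by rewrite gdens_normal_pdf normal_pdf_ge0. Qed.

Lemma measurable_gdens : measurable_fun setT gdens.
Proof.
have -> : gdens = normal_pdf 0 sigma by apply/funext/gdens_normal_pdf.
exact: measurable_normal_pdf.
Qed.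

(** The product density depends only on [x ^+ 2 + y ^+ 2], which rotations preserve. *)
Lemma gdens_rotation (c s x y : R) : (c ^+ 2 + s ^+ 2 = 1)%R ->
  (gdens (c * x - s * y) * gdens (s * x + c * y) = gdens x * gdens y)%R.
Proof.
move=> cs1; rewrite /Defs.gdens !(mulrACA _ (expR _)) -!expRD -!mulrDl.
suff -> : (- (c * x - s * y) ^+ 2 - (s * x + c * y) ^+ 2 = - x ^+ 2 - y ^+ 2)%R.
  by [].
transitivity (- (c ^+ 2 + s ^+ 2) * (x ^+ 2 + y ^+ 2))%R; first by ring.
by rewrite cs1; ring.
Qed.

Lemma gauss_int_ge0 g : (forall x, 0 <= g x) -> 0 <= gauss_int g.
Proof.
by move=> g0; apply: integral_ge0 => x _; rewrite mule_ge0// lee_fin gdens_ge0.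
Qed.

Lemma eq_gauss_int f g : f =1 g -> gauss_int f = gauss_int g.
Proof. by move=> fg; apply: eq_integral => x _; rewrite fg. Qed.

Lemma measurable_gdensM (d : measure_display) (T : measurableType d)
    (f : T -> R) (g : T -> \bar R) :
  measurable_fun setT f -> measurable_fun setT g ->
  measurable_fun setT (fun x => (gdens (f x))%:E * g x).
Proof.
move=> mf mg; apply: emeasurable_funM => //; apply/measurable_EFinP.
exact: measurableT_comp measurable_gdens mf.
Qed.

Lemma gauss_int_cst (c : \bar R) : 0 <= c -> gauss_int (fun=> c) = c.
Proof.
move=> c0; rewrite /gauss_int ge0_integralZr//=; last 2 first.
- by apply/measurable_EFinP; exact: measurable_gdens.
- by move=> x _; rewrite lee_fin gdens_ge0.
under eq_integral do rewrite gdens_normal_pdf.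
by rewrite integral_normal_pdf mul1e.
Qed.

Lemma gauss_intD f g : measurable_fun setT f -> measurable_fun setT g ->
  (forall x, 0 <= f x) -> (forall x, 0 <= g x) ->
  gauss_int (fun x => f x + g x) = gauss_int f + gauss_int g.
Proof.
move=> mf mg f0 g0; rewrite /gauss_int.
under eq_integral do rewrite ge0_muleDr//.
have gd x : 0 <= (gdens x)%:E by rewrite lee_fin gdens_ge0.
by rewrite ge0_integralD//=; [move=> *; exact: mule_ge0|
  exact: measurable_gdensM|move=> *; exact: mule_ge0|exact: measurable_gdensM].
Qed.

Lemma le_gauss_int f g : measurable_fun setT f -> measurable_fun setT g ->
  (forall x, 0 <= f x) -> (forall x, f x <= g x) ->
  gauss_int f <= gauss_int g.
Proof.
move=> mf mg f0 fg.
have gd x : 0 <= (gdens x)%:E by rewrite lee_fin gdens_ge0.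
apply: ge0_le_integral => //=.
- by move=> x _; exact: mule_ge0.
- exact: measurable_gdensM.
- exact: measurable_gdensM.
- by move=> x _; exact: lee_wpmul2l.
Qed.

Lemma measurable_gauss_int (d : measure_display) (T : measurableType d)
    (f : T * R -> \bar R) : measurable_fun setT f -> (forall z, 0 <= f z) ->
  measurable_fun setT (fun t => gauss_int (fun x => f (t, x))).
Proof.
move=> mf f0; apply: (measurable_fun_fubini_tonelli_F (m2 := mu)
    (fun z : T * R => (gdens z.2)%:E * f z)).
  exact: measurable_gdensM.
by move=> z; rewrite mule_ge0// lee_fin gdens_ge0.
Qed.

(** Moving both densities inside gives a plain Lebesgue double integral, to which Tonelli and the
    rotation invariance apply. *)
Lemma gauss_int2E (f : R * R -> \bar R) :
  measurable_fun setT f -> (forall z, 0 <= f z) ->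
  gauss_int (fun x => gauss_int (fun y => f (x, y))) =
  \int[mu]_x \int[mu]_y ((gdens x * gdens y)%:E * f (x, y)).
Proof.
move=> mf f0; apply: eq_integral => x _.
rewrite -ge0_integralZl//=.
- by apply: eq_integral => y _; rewrite EFinM muleA.
- by apply: measurable_gdensM => //; exact: measurableT_comp mf _.
- by move=> y _; rewrite mule_ge0// lee_fin gdens_ge0.
- by rewrite lee_fin gdens_ge0.
Qed.

Let measurable_gdens2M (f : R * R -> \bar R) : measurable_fun setT f ->
  measurable_fun setT (fun z : R * R => (gdens z.1 * gdens z.2)%:E * f z).
Proof.
move=> mf; apply: emeasurable_funM => //; apply/measurable_EFinP.
by apply: measurable_funM; apply: measurableT_comp measurable_gdens _.
Qed.

Let gdens2M_ge0 (f : R * R -> \bar R) : (forall z, 0 <= f z) ->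
  forall z : R * R, 0 <= (gdens z.1 * gdens z.2)%:E * f z.
Proof. by move=> f0 z; rewrite mule_ge0// lee_fin mulr_ge0 ?gdens_ge0. Qed.

Lemma gauss_int_swap (f : R * R -> \bar R) :
  measurable_fun setT f -> (forall z, 0 <= f z) ->
  gauss_int (fun x => gauss_int (fun y => f (x, y))) =
  gauss_int (fun y => gauss_int (fun x => f (x, y))).
Proof.
move=> mf f0; rewrite gauss_int2E//.
transitivity (\int[mu]_y \int[mu]_x ((gdens x * gdens y)%:E * f (x, y))).
  exact: (fubini_tonelli (m1 := mu) (m2 := mu) _ (measurable_gdens2M mf)
    (gdens2M_ge0 f0)).
have mf' : measurable_fun setT (fun z : R * R => f (z.2, z.1)).
  by apply: (measurableT_comp mf); exact: measurable_fun_pair.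
rewrite (gauss_int2E mf' (fun z => f0 (z.2, z.1))).
apply: eq_integral => y _; apply: eq_integral => x _.
by rewrite (mulrC (gdens x)).
Qed.

(** Lebesgue measure and the product density are both rotation invariant. The condition on [s = 0]
    excludes the half turn, for which [tan (a / 2)] is infinite. *)
Lemma gauss_int_rotation (c s : R) (f : R * R -> \bar R) :
  (c ^+ 2 + s ^+ 2 = 1)%R -> (s = 0 -> c = 1)%R ->
  measurable_fun setT f -> (forall z, 0 <= f z) ->
  gauss_int (fun x => gauss_int (fun y => f (c * x - s * y, s * x + c * y)%R))
  = gauss_int (fun x => gauss_int (fun y => f (x, y))).
Proof.
move=> cs1 s0c1 mf f0; rewrite (gauss_int2E (f := f))//.
have mf' : measurable_fun setT
    (fun z : R * R => f (c * z.1 - s * z.2, s * z.1 + c * z.2)%R).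
  apply: (measurableT_comp mf); apply: measurable_fun_pair => //=.
    by apply: measurable_funB; apply: measurable_funM.
  by apply: measurable_funD; apply: measurable_funM.
rewrite (gauss_int2E mf' (fun z => f0 _)).
rewrite -(integral_rotation cs1 s0c1 (measurable_gdens2M mf) (gdens2M_ge0 f0)).
apply: eq_integral => x _; apply: eq_integral => y _ /=.
by rewrite gdens_rotation.
Qed.

End gauss.

(** * Iterated Gaussian integrals *)

Section cylinder.
Context {R : realType}.

(** Since [giter] acts on functions of whole sequences, these carry the product sigma-algebra, the
    smallest one making every coordinate measurable. *)
Definition cylinders : set (set (nat -> R)) :=
  [set A | exists t, exists2 B : set R, measurable B & A = (fun z => z t) @^-1` B].

Definition noise_space := g_sigma_algebraType cylinders.

Lemma measurable_coord (t : nat) :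
  measurable_fun setT (fun z : noise_space => (z : nat -> R) t).
Proof.
move=> _ B mB; rewrite setTI; apply: sub_sigma_algebra.
by exists t; exists B.
Qed.

(** It suffices to test generators: a condition on coordinate [t] of the updated sequence concerns
    the new value if [t = m], and the old sequence otherwise. *)
Lemma measurable_upd (m : nat) : measurable_fun setT
  (fun p : noise_space * R => upd p.1 m p.2 : noise_space).
Proof.
apply: (measurability (rT := noise_space) cylinders) => // _ [_ [t [B mB ->]] <-].
rewrite setTI -[X in measurable X]setTI.
have [tm|tm] := eqVneq t m.
- have := @measurable_snd _ _ noise_space R measurableT _ mB.
  by congr measurable; congr setI; apply/seteqP; split => p /=;
    rewrite /upd tm eqxx.
- have := measurableT_comp (measurable_coord t) (@measurable_fst _ _ noise_space R)
    measurableT mB.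
  congr measurable; congr setI; apply/seteqP; split => p /=;
  by rewrite /upd (negbTE tm).
Qed.

Lemma measurable_lincomb (m : nat) (u : nat -> R) :
  measurable_fun setT (fun z : noise_space => \sum_(t < m) u t * (z : nat -> R) t).
Proof.
apply: measurable_sum => t; apply: measurable_funM => //.
exact: measurable_coord.
Qed.

End cylinder.
Arguments noise_space : clear implicits.

Section giter.
Context {R : realType} (sigma : R) (sigma_gt0 : 0 < sigma).
Local Open Scope ereal_scope.
Implicit Types (f g : noise_space R -> \bar R) (z : nat -> R).

(** Inductions on [giter] apply their hypothesis to the function already integrated over coordinate
    [m], which must therefore be measurable again. *)
Let mstep m g : measurable_fun setT g -> (forall z, 0 <= g z) ->
  measurable_fun setT
    (fun z : noise_space R => gauss_int sigma (fun x => g (upd z m x))).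
Proof.
move=> mg g0.
apply: (measurable_gauss_int sigma_gt0 
  (f := fun p : noise_space R * R => g (upd p.1 m p.2))) => //.
exact: measurableT_comp mg (measurable_upd m).
Qed.

Let msection m g z : measurable_fun setT g ->
  measurable_fun setT (fun x => g (upd z m x)).
Proof.
move=> mg; apply: (measurableT_comp (measurableT_comp mg (measurable_upd m))
  (g := fun x : R => (z : noise_space R, x))).
exact: pair1_measurable.
Qed.

Lemma giter_ge0 m g z : (forall z, 0 <= g z) -> 0 <= giter sigma m g z.
Proof.
elim: m g => [|m IH] g g0 //=; apply: IH => z'.
exact: (gauss_int_ge0 sigma_gt0).
Qed.

Lemma giter_cst m (c : \bar R) z : 0 <= c -> giter sigma m (fun=> c) z = c.
Proof.
move=> c0; elim: m => //= m IH; rewrite -[RHS]IH; congr giter.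
by apply/funext => z'; exact: (gauss_int_cst sigma_gt0).
Qed.

Lemma giterD m f g z : measurable_fun setT f -> measurable_fun setT g ->
  (forall z, 0 <= f z) -> (forall z, 0 <= g z) ->
  giter sigma m (fun z => f z + g z) z = giter sigma m f z + giter sigma m g z.
Proof.
elim: m f g => // m IH f g mf mg f0 g0 /=.
rewrite -IH; [|exact: mstep|exact: mstep|
  by move=> ?; exact: (gauss_int_ge0 sigma_gt0)..].
congr giter; apply/funext => z'.
by apply: (gauss_intD sigma_gt0) => //; exact: msection.
Qed.

Lemma giter_sum m (I : Type) (r : seq I)
    (F : I -> noise_space R -> \bar R) z :
  (forall i, measurable_fun setT (F i)) ->
  (forall i z, 0 <= F i z) ->
  giter sigma m (fun z => \sum_(i <- r) F i z) z =
  \sum_(i <- r) giter sigma m (F i) z.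
Proof.
move=> mF F0; elim: r => [|i r IH].
  under [X in giter _ _ X]eq_fun do rewrite big_nil.
  by rewrite big_nil giter_cst.
under [X in giter _ _ X]eq_fun do rewrite big_cons.
rewrite big_cons -IH giterD//; first exact: emeasurable_sum.
by move=> z'; apply: sume_ge0.
Qed.

Lemma le_giter m f g z : measurable_fun setT f -> measurable_fun setT g ->
  (forall z, 0 <= f z) -> (forall z, f z <= g z) ->
  giter sigma m f z <= giter sigma m g z.
Proof.
elim: m f g => //= m IH f g mf mg f0 fg.
have g0 z' : 0 <= g z' by exact: le_trans (fg z').
apply: IH; [exact: mstep|exact: mstep| |].
  by move=> z'; exact: (gauss_int_ge0 sigma_gt0).
by move=> z'; apply: (le_gauss_int sigma_gt0) => //; exact: msection.
Qed.

End giter.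

(** * Joint law of two linear forms in the noise *)

(** As [a] is nonnegative, the angle can avoid the half turn, as [gauss_int_rotation] requires; at
    the origin the angle is set to 0. *)
Lemma polar_coordinates (R : realType) (a p : R) : 0 <= a ->
  exists r c s : R, [/\ 0 <= r, c ^+ 2 + s ^+ 2 = 1, s = 0 -> c = 1,
    a = r * c & p = r * s].
Proof.
move=> a0; pose r := Num.sqrt (a ^+ 2 + p ^+ 2).
have r2 : r ^+ 2 = a ^+ 2 + p ^+ 2 by rewrite sqr_sqrtr// addr_ge0 ?sqr_ge0.
have [r0|r0] := eqVneq r 0.
  exists 0, 1, 0; split => //; first by ring.
    by rewrite mul0r; apply/eqP; rewrite -sqrf_eq0; apply/eqP; nra.
  by rewrite mul0r; apply/eqP; rewrite -sqrf_eq0; apply/eqP; nra.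
exists r, (a / r), (p / r); split; [exact: sqrtr_ge0| | |by field|by field].
  by rewrite !expr_div_n -mulrDl -r2 divff// sqrf_eq0.
move/eqP; rewrite mulf_eq0 invr_eq0 (negbTE r0) orbF => /eqP p0.
have -> : r = a by rewrite /r p0 expr0n addr0 sqrtr_sqr ger0_norm.
rewrite divff//; apply: contra_neq r0 => a00.
by rewrite /r a00 p0 expr0n addr0 sqrtr0.
Qed.

Section projection.
Context {R : realType} (sigma : R) (sigma_gt0 : 0 < sigma).
Local Open Scope ereal_scope.
Local Notation gI := (gauss_int sigma).

(* The pair of Gaussian variables [u.z] and [v.z] is distributed as
   [(a x, b x + c y)]: the Cholesky factor of their Gram matrix is updated one
   coordinate at a time by two plane rotations. *)
Lemma giter_projection (m : nat) (u v : nat -> R) : exists a b c : R,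
  [/\ (0 <= a)%R, (0 <= c)%R, (a ^+ 2 = \sum_(t < m) u t ^+ 2)%R,
    (a * b = \sum_(t < m) u t * v t)%R &
    (b ^+ 2 + c ^+ 2 = \sum_(t < m) v t ^+ 2)%R] /\
  forall h : R * R -> \bar R,
    measurable_fun setT h -> (forall z, 0 <= h z) -> forall z,
    giter sigma m (fun z => h (\sum_(t < m) u t * z t, \sum_(t < m) v t * z t)%R) z
    = gI (fun x => gI (fun y => h (a * x, b * x + c * y)%R)).
Proof.
elim: m => [|m [a [b [c [[a0 c0 aE bE cE] IH]]]]].
  exists 0%R, 0%R, 0%R; rewrite !big_ord0; split; first by split => //; ring.
  move=> h mh h0 z /=; rewrite !big_ord0.
  rewrite (eq_gauss_int sigma (g := fun=> h (0, 0)%R)) ?gauss_int_cst// => x.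
  rewrite (eq_gauss_int sigma (g := fun=> h (0, 0)%R)) ?gauss_int_cst// => y.
  by rewrite !mul0r addr0.
(* The rotation by [(k, s)] turns [(a, u m)] into [(r, 0)], so that the first form again uses a
   single variable. *)
have [r [k [s [r0 ks1 sk aer uer]]]] := polar_coordinates (u m) a0.
(* The same rotation sends [(b, v m)] to [(b * k + v m * s, be)]; a second one then merges [c] and
   [be] into [r']. *)
pose be := (v m * k - b * s)%R.
have [r' [k' [s' [r'0 ks1' sk' cer beer]]]] := polar_coordinates be c0.
exists r, (b * k + v m * s)%R, r'; rewrite !big_ord_recr/=; split.
  rewrite -aE -bE -cE; split => //.
  - by rewrite aer uer; transitivity (r ^+ 2 * (k ^+ 2 + s ^+ 2))%R;
      [rewrite ks1; ring|ring].
  - by rewrite aer uer; ring.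
  - transitivity ((b * k + v m * s) ^+ 2 + (c ^+ 2 + be ^+ 2))%R.
      by rewrite cer beer; transitivity
        ((b * k + v m * s) ^+ 2 + r' ^+ 2 * (k' ^+ 2 + s' ^+ 2))%R;
        [rewrite ks1'; ring|ring].
    transitivity ((b ^+ 2 + v m ^+ 2) * (k ^+ 2 + s ^+ 2) + c ^+ 2)%R;
      [rewrite /be; ring|rewrite ks1; ring].
move=> h mh h0 z.
(* The newest coordinate is absorbed into the test function, so that the induction hypothesis covers
   the others. *)
pose h' (q : R * R) := gI (fun x => h (q.1 + u m * x, q.2 + v m * x)%R).
have mh' : measurable_fun setT h'.
  apply: (measurable_gauss_int sigma_gt0
    (f := fun q : (R * R) * R => h (q.1.1 + u m * q.2, q.1.2 + v m * q.2)%R)) => //.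
  apply: (measurableT_comp mh); apply: measurable_fun_pair => /=;
  apply: measurable_funD; (try by apply: measurable_funM);
  by apply: measurableT_comp => //.
have h'0 q : 0 <= h' q by exact: (gauss_int_ge0 sigma_gt0).
transitivity (giter sigma m
    (fun z => h' (\sum_(t < m) u t * z t, \sum_(t < m) v t * z t)%R) z).
  rewrite /=; congr giter; apply/funext => z'; apply: eq_gauss_int => x.
  have E (w : nat -> R) :
      (\sum_(t < m) w t * upd z' m x t = \sum_(t < m) w t * z' t)%R.
    by apply: eq_bigr => t _; rewrite /upd ltn_eqF.
  by rewrite !big_ord_recr/= !E /upd eqxx.
rewrite (IH _ mh' h'0).
(* The variable [y] is moved innermost, leaving the two variables to be rotated as the outer
   pair. *)
pose H (q : R * R) :=
  gI (fun y => h (a * q.1 + u m * q.2, b * q.1 + v m * q.2 + c * y)%R).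
have lin2 (d : measure_display) (T : measurableType d) (f g : T -> R) (al be' : R) :
    measurable_fun setT f -> measurable_fun setT g ->
    measurable_fun setT (fun q => al * f q + be' * g q)%R.
  by move=> mf mg; apply: measurable_funD; apply: measurable_funM.
have mH : measurable_fun setT H.
  apply: (measurable_gauss_int sigma_gt0
    (f := fun q : (R * R) * R =>
      h (a * q.1.1 + u m * q.1.2, b * q.1.1 + v m * q.1.2 + c * q.2)%R)) => //.
  have m11 : measurable_fun setT (fun q : (R * R) * R => q.1.1).
    exact: measurableT_comp.
  have m12 : measurable_fun setT (fun q : (R * R) * R => q.1.2).
    exact: measurableT_comp.
  apply: (measurableT_comp mh); apply: measurable_fun_pair => /=.
    exact: lin2.
  by apply: measurable_funD; [exact: lin2|exact: measurable_funM].
transitivity (gI (fun x1 => gI (fun x => H (x1, x)))).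
  apply: eq_gauss_int => x1.
  pose L (q : R * R) := h (a * x1 + u m * q.2, b * x1 + c * q.1 + v m * q.2)%R.
  have mL : measurable_fun setT L.
    apply: (measurableT_comp mh); apply: measurable_fun_pair => /=.
      by apply: measurable_funD => //; exact: measurable_funM.
    apply: measurable_funD; last exact: measurable_funM.
    by apply: measurable_funD => //; exact: measurable_funM.
  transitivity (gI (fun y => gI (fun x => L (y, x)))); first by [].
  rewrite (gauss_int_swap sigma_gt0 mL (fun=> h0 _)).
  apply: eq_gauss_int => x; apply: eq_gauss_int => y; rewrite /L /=.
  by congr h; congr pair; ring.
have H0 q : 0 <= H q by exact: (gauss_int_ge0 sigma_gt0).
rewrite -(gauss_int_rotation sigma_gt0 ks1 sk mH H0).
apply: eq_gauss_int => x.
(* With the first form reduced to [r * x], the second rotation acts on the other two variables at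
   fixed [x]. *)
pose K (q : R * R) := h (r * x, (b * k + v m * s) * x + (c * q.1 + be * q.2))%R.
have mK : measurable_fun setT K.
  apply: (measurableT_comp mh); apply: measurable_fun_pair => //=.
  by apply: measurable_funD => //; exact: lin2.
transitivity (gI (fun x2 => gI (fun y => K (x2, y)))).
  rewrite (gauss_int_swap sigma_gt0 mK (fun=> h0 _)).
  apply: eq_gauss_int => y; apply: eq_gauss_int => x2; rewrite /K /=.
  congr h; congr pair.
    rewrite aer uer; transitivity (r * (k ^+ 2 + s ^+ 2) * x)%R;
    [ring|rewrite ks1; ring].
  by rewrite /be; ring.
rewrite -(gauss_int_rotation sigma_gt0 ks1' sk' mK (fun=> h0 _)).
apply: eq_gauss_int => y.
(* After the second rotation the integrand is constant in the last variable, whose law has mass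
   1. *)
rewrite -[RHS](gauss_int_cst sigma_gt0 (h0 _)).
apply: eq_gauss_int => w; rewrite /K /=; congr h; congr pair; congr (_ + _)%R.
rewrite cer beer; transitivity (r' * (k' ^+ 2 + s' ^+ 2) * y)%R;
[ring|rewrite ks1'; ring].
Qed.

End projection.

(** * The Gaussian tail *)

Section tail.
Context {R : realType} (sigma : R) (sigma_gt0 : 0 < sigma).
Local Open Scope ereal_scope.
Local Notation mu := (@lebesgue_measure R).

(** Substitute [x = sigma * t]; the derivative [sigma] cancels the one in the normalising
    constant. *)
Lemma gauss_tail (a : R) :
  \int[mu]_(x in `[a, +oo[) (gdens sigma x)%:E = Qfun (a / sigma).
Proof.
pose F (x : R^o) : R^o := (sigma * x)%R.
have F'E : F^`()%classic = cst sigma.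
  apply/funext => x; rewrite /F derive1E deriveM// derive_id derive_cst.
  by rewrite scaler0 addr0 scaler1.
have cF : continuous F by move=> x; exact: mulrl_continuous.
have cG : continuous (gdens sigma).
  have -> : gdens sigma = normal_pdf 0 sigma.
    by apply/funext; exact: gdens_normal_pdf.
  by apply: continuous_normal_pdf; rewrite gt_eqF.
have Fa : F (a / sigma)%R = a by rewrite /F mulrCA divff ?mulr1// gt_eqF.
rewrite -[in LHS]Fa (increasing_ge0_integration_by_substitutiony (F := F)).
- rewrite /Qfun; apply: eq_integral => x _; rewrite F'E !fctE/=; congr EFin.
  rewrite /gdens /F; have -> : (- (sigma * x) ^+ 2 / (2 * sigma ^+ 2)
      = - x ^+ 2 / (2 * 1 ^+ 2))%R by field; rewrite gt_eqF.
  rewrite mulrAC; congr (_ * _)%R; field.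
  by rewrite !gt_eqF// sqrtr_gt0 mulr_gt0// pi_gt0.
- by move=> x y _ _ xy; rewrite /F ltr_pM2l.
- by rewrite F'E => ? _; exact: cvg_cst.
- by rewrite F'E; exact: is_cvg_cst.
- by rewrite F'E; exact: is_cvg_cst.
- split; first by move=> x _; apply: derivableM.
  by apply: cvg_at_right_filter; exact: cF.
- apply/gt0_cvgMry => //; exact: cvg_id.
- exact: continuous_subspaceT.
- by move=> x _; exact: gdens_ge0.
Qed.

End tail.

(** * Codewords and decoding events *)

Lemma wH_gt0 (n : nat) (c : 'rV['F_2]_n) : c != 0 -> (0 < wH c)%N.
Proof. by move=> /rV0Pn[t ct]; apply/card_gt0P; exists t; exact: mem_set. Qed.

Lemma wH0 (n : nat) : wH (0 : 'rV['F_2]_n) = 0%N.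
Proof.
by rewrite /wH; apply: eq_card0 => t; apply/memNset => /=; rewrite mxE eqxx.
Qed.

Lemma wH_le (n : nat) (c : 'rV['F_2]_n) : (wH c <= n)%N.
Proof. by rewrite /wH (leq_trans (max_card _))// card_ord. Qed.

Section codewords.
Context {R : realType} {n : nat}.
Implicit Types (c : 'rV['F_2]_n) (z : nat -> R).

Definition bit c (t : 'I_n) : R := (c 0 t != 0)%:R.

Lemma bit_sqr c t : bit c t ^+ 2 = bit c t.
Proof. by rewrite /bit; case: (_ != _); rewrite ?expr1n ?expr0n. Qed.

Lemma sum_bit c : \sum_(t < n) bit c t = (wH c)%:R.
Proof.
rewrite /bit -natr_sum; congr (_%:R); rewrite /wH -sum1_card.
rewrite [RHS]big_mkcond/=; apply: eq_bigr => t _.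
case: (boolP (c 0 t != 0)) => ct.
  by rewrite mem_set.
by rewrite memNset//; exact/negP.
Qed.

(** Subtraction in ['F_2] is exclusive or; the four cases are checked. *)
Lemma bitB c c' t : bit (c - c') t = (bit c t - bit c' t) ^+ 2.
Proof.
rewrite /bit !mxE.
case: (c 0 t) => [[|[|//]] ?]; case: (c' 0 t) => [[|[|//]] ?];
  rewrite -!val_eqE /=; ring.
Qed.

(** Polarization: [2 x y = x^2 + y^2 - (x - y)^2], where each bit is its own square. *)
Lemma sum_bitM c c' : \sum_(t < n) bit c t * bit c' t =
  ((wH c)%:R + (wH c')%:R - (wH (c' - c))%:R) / 2.
Proof.
rewrite -!sum_bit -big_split -sumrB mulr_suml; apply: eq_bigr => t _.
transitivity ((bit c t ^+ 2 + bit c' t ^+ 2 - (bit c' t - bit c t) ^+ 2) / 2).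
  by field.
by rewrite bitB !bit_sqr.
Qed.

(* Unit vector from the image of the zero codeword to that of [c], extended by
   [0] beyond index [n]. *)
Definition direction c (t : nat) : R :=
  oapp (fun i : 'I_n => - bit c i / Num.sqrt (wH c)%:R) 0 (insub t).

Lemma directionE c (t : 'I_n) :
  direction c t = - bit c t / Num.sqrt (wH c)%:R.
Proof. by rewrite /direction valK. Qed.

(** The inner product of two unit vectors is the cosine of their angle; the right-hand side is the
    argument of [acos] in [p3]. *)
Lemma sum_directionM c c' : (0 < wH c)%N -> (0 < wH c')%N ->
  \sum_(t < n) direction c t * direction c' t =
  ((wH c)%:R + (wH c')%:R - (wH (c' - c))%:R) /
    (2 * Num.sqrt ((wH c)%:R * (wH c')%:R)).
Proof.
move=> c0 c'0; have sc := sqrtr_gt0 (wH c)%:R; have sc' := sqrtr_gt0 (wH c')%:R.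
rewrite sqrtrM ?ler0n// invfM mulrA -sum_bitM mulr_suml.
apply: eq_bigr => t _; rewrite !directionE; field.
by rewrite !gt_eqF ?sc ?sc' ?ltr0n.
Qed.

Lemma sum_direction_sqr c : (0 < wH c)%N ->
  \sum_(t < n) direction c t ^+ 2 = 1.
Proof.
move=> c0; under eq_bigr do rewrite directionE expr_div_n sqrrN bit_sqr
  sqr_sqrtr ?ler0n//.
by rewrite -mulr_suml sum_bit divff// pnatr_eq0 -lt0n.
Qed.

(** The two images are [2 * sqrt (wH c)] apart, so their bisecting hyperplane lies at distance
    [sqrt (wH c)] from the transmitted point. *)
Definition closer c z : bool :=
  Num.sqrt (wH c)%:R <= \sum_(t < n) direction c t * z t.

Lemma dist2_le_closer c z : (0 < wH c)%N ->
  (dist2 z (bpsk R (0 : 'rV['F_2]_n)) (bpsk R c)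
     <= dist2 z (bpsk R (0 : 'rV['F_2]_n)) (bpsk R (0 : 'rV['F_2]_n))) = closer c z.
Proof.
move=> c0; have sc : 0 < Num.sqrt (wH c)%:R :> R by rewrite sqrtr_gt0 ltr0n.
rewrite -subr_ge0 /dist2 -sumrB.
(* Termwise, [z^2 - (z + 2 x)^2 = 4 (- x z - x^2)] with [x] the bit of [c], and [x^2 = x]. *)
have -> : \sum_(t < n) ((bpsk R 0 t + z t - bpsk R 0 t) ^+ 2
    - (bpsk R (0 : 'rV_n) t + z t - bpsk R c t) ^+ 2) =
  4 * (- (\sum_(t < n) bit c t * z t) - (wH c)%:R).
  rewrite -sum_bit -sumrN -sumrB mulr_sumr; apply: eq_bigr => t _.
  rewrite /bpsk mxE eqxx/= -/(bit c t) -[X in _ = _ * (_ - X)]bit_sqr; ring.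
rewrite pmulr_rge0// subr_ge0 /closer.
have -> : \sum_(t < n) direction c t * z t =
    - (\sum_(t < n) bit c t * z t) / Num.sqrt (wH c)%:R.
  rewrite mulNr mulr_suml -sumrN; apply: eq_bigr => t _.
  by rewrite directionE; ring.
by rewrite ler_pdivlMr// -expr2 sqr_sqrtr ?ler0n.
Qed.

Lemma error_eventE (C : {set 'rV['F_2]_n}) z :
  error_event C z = has (closer^~ z) (enum (C :\ 0)).
Proof.
apply/existsP/hasP.
  move=> [c /and3P[cC c0 cz]]; exists c; first by rewrite mem_enum in_setD1 c0.
  by rewrite -dist2_le_closer// wH_gt0.
move=> [c]; rewrite mem_enum in_setD1 => /andP[c0 cC] cz; exists c.
by rewrite cC c0/= dist2_le_closer// wH_gt0.
Qed.

Lemma measurable_closer c : measurable_fun setT (closer c : noise_space R -> bool).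
Proof. by apply: measurable_fun_ler => //; exact: measurable_lincomb. Qed.

End codewords.

(** * Probabilities of the decoding events *)

Section noise_prob.
Context {R : realType} (sigma : R) (sigma_gt0 : 0 < sigma) {n : nat}.
Local Open Scope ereal_scope.
Implicit Types (c : 'rV['F_2]_n) (P : noise_space R -> bool).
Local Notation Pr := (noise_prob sigma n).

Lemma measurable_indicator (d : measure_display) (T : measurableType d)
    (b : T -> bool) : measurable_fun setT b ->
  measurable_fun setT (fun z => (if b z then 1 else 0 : R)%:E).
Proof.
move=> mb; apply/measurable_EFinP.
by apply: measurable_fun_if => //; exact: measurable_cst.
Qed.

Lemma indicator_ge0 (b : bool) : 0 <= (if b then 1 else 0 : R)%:E.
Proof. by rewrite lee_fin; case: b. Qed.

Lemma noise_prob_ge0 P : 0 <= Pr P.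
Proof. by apply: giter_ge0 => // z; exact: indicator_ge0. Qed.

Lemma noise_prob_le1 P : measurable_fun setT P -> Pr P <= 1.
Proof.
move=> mP; rewrite -[leRHS](giter_cst sigma_gt0 n (fun=> 0%R) lee01).
apply: le_giter => //; first exact: measurable_indicator.
- by move=> z; exact: indicator_ge0.
- by move=> z; rewrite lee_fin; case: (P z).
Qed.

Lemma noise_prob_fin_num P : measurable_fun setT P -> Pr P \is a fin_num.
Proof.
move=> mP; rewrite ge0_fin_numE ?noise_prob_ge0//.
by rewrite (le_lt_trans (noise_prob_le1 mP))// ltry.
Qed.

Lemma noise_prob_closer c : (0 < wH c)%N ->
  Pr (closer c) = Qfun (Num.sqrt (wH c)%:R / sigma).
Proof.
move=> c0.
(* A single form is needed, so the same direction is used twice and [h] reads only the first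
   component. *)
have [a [b [e [[a0 _ a1 _ _] H]]]] :=
  giter_projection sigma_gt0 n (direction c) (direction c).
have {a0 a1} a1 : a = 1%R.
  apply/eqP; rewrite -(@eqrXn2 _ 2)// a1 expr1n.
  by apply/eqP; exact: sum_direction_sqr.
pose h (q : R * R) := (if Num.sqrt (wH c)%:R <= q.1 then 1 else 0 : R)%R%:E.
have mh : measurable_fun setT h.
  by apply: measurable_indicator; exact: measurable_fun_ler.
rewrite -(gauss_tail sigma_gt0).
transitivity (giter sigma n (fun z => h (\sum_(t < n) direction c t * z t,
  \sum_(t < n) direction c t * z t)%R) (fun=> 0%R)); first by [].
rewrite (H h mh (fun=> indicator_ge0 _)) a1 [RHS]integral_mkcond.
apply: eq_integral => x _; rewrite /h patchE /=.
rewrite (gauss_int_cst sigma_gt0) ?indicator_ge0//.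
rewrite mul1r mem_setE in_itv/= andbT.
by case: ifP => _; rewrite ?mule1 ?mule0.
Qed.

(** For two unit vectors at angle [th] the Cholesky factor is [(1, cos th, sin th)], so the integral
    over the region in [p3] is the probability that neither event occurs. *)
Lemma p3_complement c1 c : (0 < wH c1)%N -> (0 < wH c)%N ->
  p3 sigma (wH c1) (wH c) (wH (c - c1)) =
  1 - Pr (fun z => ~~ closer c1 z && ~~ closer c z).
Proof.
move=> c10 c0; rewrite /p3; congr (1 - _).
have [a [b [e [[a0 e0 a1 ab be] H]]]] :=
  giter_projection sigma_gt0 n (direction c1) (direction c).
have {a0 a1} a1 : a = 1%R.
  apply/eqP; rewrite -(@eqrXn2 _ 2)// a1 expr1n.
  by apply/eqP; exact: sum_direction_sqr.
subst a; rewrite mul1r sum_directionM// in ab.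
rewrite -ab.
rewrite sum_direction_sqr// in be.
have b1 : (-1 <= b <= 1)%R.
  by rewrite -ler_norml -(@expr_le1 _ 2)// real_normK ?num_real// -be lerDl sqr_ge0.
have -> : cos (acos b) = b by apply: acosK; rewrite in_itv.
(* Both are nonnegative square roots of [1 - b ^+ 2]. *)
have -> : sin (acos b) = e.
  rewrite sin_acos// -be addrAC subrr add0r sqrtr_sqr ger0_norm//.
pose h (q : R * R) := (if (q.1 < Num.sqrt (wH c1)%:R) &&
  (q.2 < Num.sqrt (wH c)%:R) then 1 else 0 : R)%R%:E.
have mh : measurable_fun setT h.
  apply: measurable_indicator; apply: measurable_and; exact: measurable_fun_ltr.
transitivity (giter sigma n (fun z => h (\sum_(t < n) direction c1 t * z t,
  \sum_(t < n) direction c t * z t)%R) (fun=> 0%R)); last first.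
  by congr giter; apply/funext => z; rewrite /h /closer -!ltNge.
have mh' : measurable_fun setT (fun q : R * R => h (q.1, b * q.1 + e * q.2)%R).
  apply: (measurableT_comp mh); apply: measurable_fun_pair => //=.
  by apply: measurable_funD; exact: measurable_funM.
rewrite (H h mh (fun=> indicator_ge0 _)).
transitivity (gauss_int sigma (fun x => gauss_int sigma
    (fun y => h (x, b * x + e * y)%R))); last first.
  by apply: eq_gauss_int => x; apply: eq_gauss_int => y; rewrite mul1r.
rewrite (gauss_int2E sigma_gt0 mh' (fun=> indicator_ge0 _)).
apply: eq_integral => x _; apply: eq_integral => y _.
by rewrite EFinM /h/= (mulrC x) (mulrC y).
Qed.

Lemma p3_split c1 c : (0 < wH c1)%N -> (0 < wH c)%N ->
  p3 sigma (wH c1) (wH c) (wH (c - c1)) =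
  Pr (fun z => closer c z && ~~ closer c1 z) + Pr (closer c1).
Proof.
move=> c10 c0; rewrite p3_complement//.
set A := fun z => ~~ _ && _; set B := fun z => closer c z && _.
have mN c' : measurable_fun setT (fun z : noise_space R => ~~ closer c' z).
  exact: (measurable_neg (measurable_closer c')).
have mA : measurable_fun setT (A : noise_space R -> bool).
  by apply: measurable_and.
have mB : measurable_fun setT (B : noise_space R -> bool).
  by apply: measurable_and => //; exact: measurable_closer.
have mC := measurable_closer (R := R) c1.
(* The three events partition the space; finiteness of [Pr A] then allows cancelling it. *)
have -> : 1 = Pr B + Pr (closer c1) + Pr A.
  rewrite -(giter_cst sigma_gt0 n (fun=> 0%R) lee01).
  rewrite /noise_prob -!giterD//; try exact: measurable_indicator;
    try by move=> z; rewrite ?adde_ge0 ?indicator_ge0.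
  - congr giter; apply/funext => z; rewrite /A /B.
    by case: (closer c z); case: (closer c1 z); rewrite /= ?adde0 ?add0e.
  - by apply: emeasurable_funD; exact: measurable_indicator.
by rewrite addeK// noise_prob_fin_num.
Qed.

Lemma measurable_has (I : Type) (F : I -> noise_space R -> bool) (s : seq I) :
  (forall i, measurable_fun setT (F i)) ->
  measurable_fun setT (fun z => has (F^~ z) s).
Proof.
move=> mF; elim: s => [|i s IH] /=; first exact: measurable_cst.
exact: measurable_or.
Qed.

(* Each codeword other than [c1] is charged only for the part of its event lying
   outside that of [c1]. *)
Lemma error_prob_le (C : {set 'rV['F_2]_n}) c1 : c1 \in C -> (0 < wH c1)%N ->
  error_prob sigma C <= Pr (closer c1) +
    \sum_(c <- enum (C :\ (0 : 'rV['F_2]_n)%R :\ c1))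
      Pr (fun z => closer c z && ~~ closer c1 z).
Proof.
move=> c1C c10; rewrite /error_prob /noise_prob.
have mB c : measurable_fun setT
    (fun z : noise_space R => closer c z && ~~ closer c1 z).
  apply: measurable_and; first exact: measurable_closer.
  exact: (measurable_neg (measurable_closer c1)).
have mC := measurable_closer (R := R) c1.
rewrite -giter_sum//; last 2 first.
- by move=> c; exact: measurable_indicator.
- by move=> c z; exact: indicator_ge0.
have mS : measurable_fun setT (fun z : noise_space R =>
    \sum_(c <- enum (C :\ (0 : 'rV['F_2]_n)%R :\ c1))
      (if closer c z && ~~ closer c1 z then 1 else 0 : R)%:E).
  by apply: emeasurable_sum => c; exact: measurable_indicator.
have S0 z : 0 <= \sum_(c <- enum (C :\ (0 : 'rV['F_2]_n)%R :\ c1))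
      (if closer c z && ~~ closer c1 z then 1 else 0 : R)%:E.
  by apply: sume_ge0 => c _; exact: indicator_ge0.
rewrite -giterD//; last 2 first.
- exact: measurable_indicator.
- by move=> z; exact: indicator_ge0.
apply: le_giter => //.
- apply: measurable_indicator.
  have -> : error_event C = (fun z : noise_space R =>
      has (closer^~ z) (enum (C :\ (0 : 'rV['F_2]_n)%R))).
    by apply/funext => z; exact: error_eventE.
  by apply: measurable_has => c; exact: measurable_closer.
- by apply: emeasurable_funD => //; exact: measurable_indicator.
- by move=> z; exact: indicator_ge0.
move=> z; rewrite error_eventE.
case: hasP => [[c cC cz]|_]; last first.
  by apply: adde_ge0; [exact: indicator_ge0|exact: S0].
(* If [closer c1 z] holds, the first indicator is already 1. Otherwise the witness [c] differs from
   [c1], and its term in the sum is 1. *)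
have [c1z|c1z] := boolP (closer c1 z); first last.
  rewrite add0e (bigD1_seq c)/= ?enum_uniq//.
    by rewrite cz/= leeDl//; apply: sume_ge0 => ? _; exact: indicator_ge0.
  move: cC; rewrite !mem_enum !in_setD1 => ->; rewrite andbT.
  by apply: contraNneq c1z => <-.
by rewrite leeDl//; apply: sume_ge0 => ? _; exact: indicator_ge0.
Qed.

End noise_prob.

(** * Triangle spectrum and the final bound *)

(** Positivity of [i] excludes the zero codeword, and positivity of [j] excludes [c1]. *)
Lemma tri_specE (n : nat) (C : {set 'rV['F_2]_n}) (c1 : 'rV['F_2]_n)
    (i j : nat) : (0 < i)%N -> (0 < j)%N ->
  tri_spec C c1 i j =
  (\sum_(c in C :\ 0%R :\ c1) ((wH c == i) && (wH (c - c1)%R == j)))%N.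
Proof.
move=> i0 j0; rewrite /tri_spec -sum1_card -big_mkcondr; apply: eq_bigl => c.
rewrite inE !in_setD1; case: (eqVneq c c1) => [->|_] /=.
  by rewrite subrr wH0 (ltn_eqF j0) !andbF.
by case: (eqVneq c 0) => [->|_] //=; rewrite wH0 (ltn_eqF i0) andbF.
Qed.

(** Each remaining codeword is counted at exactly one pair [(i, j)], whose entries both lie between
    1 and [n]. *)
Lemma sum_tri_spec (R : realType) (n : nat) (C : {set 'rV['F_2]_n})
    (c1 : 'rV['F_2]_n) (F : nat -> nat -> \bar R) :
  (\sum_(1 <= i < n.+1) \sum_(1 <= j < n.+1) ((tri_spec C c1 i j)%:R%:E * F i j)
   = \sum_(c in C :\ (0 : 'rV['F_2]_n)%R :\ c1) F (wH c) (wH (c - c1)%R))%E.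
Proof.
transitivity (\sum_(1 <= i < n.+1) \sum_(1 <= j < n.+1)
   \sum_(c in C :\ (0 : 'rV['F_2]_n)%R :\ c1)
     if wH c == i then if wH (c - c1)%R == j then F i j else 0 else 0)%E.
  apply: eq_big_nat => i /andP[i0 _]; apply: eq_big_nat => j /andP[j0 _].
  (* Distributing over extended reals is safe because the coefficients are nonnegative, whatever the
     value of [F i j]. *)
  rewrite tri_specE// natr_sum -sumEFin ge0_sume_distrl; last first.
    by move=> c _; rewrite lee_fin ler0n.
  apply: eq_bigr => c _.
  by case: (wH c == i); case: (wH (c - c1) == j); rewrite ?mul1e ?mul0e.
under eq_bigr do rewrite exchange_big/=.
rewrite exchange_big/=; apply: eq_bigr => c.
rewrite !in_setD1 => /and3P[cc1 c0 _].
rewrite (eq_bigr (fun i => if i == wH c then F (wH c) (wH (c - c1)%R) else 0)%E).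
  by rewrite -big_mkcond big_nat1_eq wH_gt0//= ltnS wH_le.
move=> i _; rewrite eq_sym; case: eqP => [->|_]; last by rewrite big1.
under eq_bigr do rewrite eq_sym.
by rewrite -big_mkcond big_nat1_eq wH_gt0 ?subr_eq0//= ltnS wH_le.
Qed.

Theorem theorem1 (R : realType) (n k : nat) (C : {set 'rV['F_2]_n})
    (c1 : 'rV['F_2]_n) (sigma : R) :
  0 < sigma ->
  0 \in C ->
  (forall a b, a \in C -> b \in C -> a + b \in C) ->
  #|C| = (2 ^ k)%N ->
  c1 \in C ->
  (1 <= wH c1)%N ->
  (error_prob sigma C <=
     - ((2%:R ^+ k - 3%:R : R)%:E * Qfun (Num.sqrt (wH c1)%:R / sigma))
     + \sum_(1 <= i < n.+1) \sum_(1 <= j < n.+1)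
         ((tri_spec C c1 i j)%:R%:E * p3 sigma (wH c1) i j))%E.
Proof.
move=> sigma0 C0 _ cardC c1C c10.
apply: (le_trans (error_prob_le sigma0 c1C c10)).
have c1_neq0 : c1 != 0 by apply: contraTneq c10 => ->; rewrite wH0.
have cardS : (#|C :\ 0 :\ c1|%:R = 2 ^+ k - 2 :> R)%R.
  have : #|C| = (2 + #|C :\ 0%R :\ c1|)%N.
    by rewrite (cardsD1 0) C0 (cardsD1 c1 (C :\ 0)) in_setD1 c1_neq0 c1C addnA.
  rewrite cardC => /(congr1 (GRing.natmul (1 : R))); rewrite natrX natrD => ->.
  by ring.
rewrite sum_tri_spec -big_enum/=.
pose B (c : 'rV['F_2]_n) (z : nat -> R) := closer c z && ~~ closer c1 z.
have mB c : measurable_fun setT (B c : noise_space R -> bool).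
  apply: measurable_and; first exact: measurable_closer.
  exact: (measurable_neg (measurable_closer c1)).
(* All probabilities are finite, so the comparison can be carried out in [R]. *)
have PB c := fineK (noise_prob_fin_num sigma0 (n := n) (mB c)).
have PQ := fineK (noise_prob_fin_num sigma0 (n := n) (measurable_closer c1)).
rewrite -(noise_prob_closer sigma0 c10) -PQ.
set q := fine _.
rewrite (eq_bigr (fun c => (fine (noise_prob sigma n (B c)))%:E))//.
rewrite [X in (_ <= _ + X)%E](eq_big_seq (fun c =>
    (fine (noise_prob sigma n (B c)) + q)%:E)); last first.
  move=> c; rewrite mem_enum !in_setD1 => /and3P[_ c0 _].
  by rewrite p3_split ?wH_gt0// -PQ -[X in (X + _)%E]PB EFinD.
rewrite !sumEFin -EFinM -EFinN -!EFinD lee_fin big_split/=.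
rewrite [X in _ <= _ + (_ + X)]big_enum/= sumr_const -[X in _ + (_ + X)]mulr_natl.
rewrite cardS.
(* The two sides agree, since [(2 ^ k - 2) q - (2 ^ k - 3) q = q]; the only inequality used is
   [error_prob_le]. *)
by rewrite le_eqVlt; apply/orP; left; apply/eqP; ring.
Qed.
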